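(* The center of a weakly nil clean ring is weakly nil clean (and thus strongly $\pi$-regular).
   Context: Rings are associative with unity, not necessarily commutative. A ring $R$ is weakly nil clean if for every $a\in R$ there exist an idempotent $e\in R$ and a nilpotent $q\in R$ such that $a-e-q\in eRa$. A ring $R$ is strongly $\pi$-regular if for every $a\in R$ there exists a positive integer $n$ such that $a^n\in a^{n+1}R$. *)

(* Defs.v *)
From HB Require Import structures.
From mathcomp Require Import all_boot all_algebra boolp.
Set Implicit Arguments.
Unset Strict Implicit.
Unset Printing Implicit Defensive.
Import GRing.Theory.
Local Open Scope ring_scope.

Definition idempotent_elt (R : pzRingType) (e : R) : Prop := e * e = e.

Definition nilpotent_elt (R : pzRingType) (q : R) : Prop :=
  exists n : nat, q ^+ n = 0.

(* [pzRingType], unlike [nzRingType], does not exclude the zero ring. *)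
Definition weakly_nil_clean (R : pzRingType) : Prop :=
  forall a : R, exists e q : R,
    [/\ idempotent_elt e, nilpotent_elt q & exists r : R, a - e - q = e * r * a].

Definition strongly_pi_regular (R : pzRingType) : Prop :=
  forall a : R, exists n : nat, (0 < n)%N /\ exists r : R, a ^+ n = a ^+ n.+1 * r.

(* Centrality in an arbitrary ring is undecidable; [`[< _ >]] turns it into the
   boolean predicate required by [subType]. *)
Definition central (R : pzRingType) : {pred R} :=
  fun x => `[< forall y : R, GRing.comm x y >].
Arguments central R : clear implicits.

Lemma centralP (R : pzRingType) (x : R) :
  reflect (forall y : R, GRing.comm x y) (x \in central R).
Proof. exact: asboolP. Qed.

Fact central_subring_closed (R : pzRingType) : subring_closed (central R).
Proof.
split=> [|x y /centralP xC /centralP yC|x y /centralP xC /centralP yC].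
- by apply/centralP => y; exact/commr_sym/commr1.
- by apply/centralP => z; apply/commr_sym/commrB; apply/commr_sym; [exact: xC|exact: yC].
- by apply/centralP => z; apply/commr_sym/commrM; apply/commr_sym; [exact: xC|exact: yC].
Qed.

Record center (R : pzRingType) : Type :=
  Center { center_val :> R; center_valP : center_val \in central R }.

HB.instance Definition _ (R : pzRingType) := [isSub for @center_val R].
HB.instance Definition _ (R : pzRingType) := [Choice of center R by <:].
HB.instance Definition _ (R : pzRingType) :=
  GRing.SubChoice_isSubPzRing.Build R (central R) (center R)
    (@central_subring_closed R).

Fact center_mulrC (R : pzRingType) : commutative (@GRing.mul (center R)).
Proof.
by move=> x y; apply: val_inj; rewrite !rmorphM /=; exact/centralP/center_valP.
Qed.

HB.instance Definition _ (R : pzRingType) :=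
  GRing.PzRing_hasCommutativeMul.Build (center R) (@center_mulrC R).

(* Main.v *)
Require Import Defs.
From mathcomp Require Import all_boot all_algebra.
Import GRing.Theory.
Local Open Scope ring_scope.

(** Let [a] be central and [a - e - q = e r a] with [q ^+ n = 0]. Multiplying by
    [1 - e] gives [(1 - e) a = (1 - e) q], hence
    [(1 - e) a ^+ n = (1 - e) q ^+ n = 0]. Multiplying by [e] gives
    [e (1 + q) = e (1 - r) a], so [e] is a multiple of [a] because [1 + q] is
    invertible. Thus [a ^+ n = e a ^+ n] is a multiple of [a ^+ n.+1]. The
    cofactor can be replaced by a central one, so the center is strongly
    pi-regular, and a commutative strongly pi-regular ring is weakly nil clean. *)

Lemma nilpotent_add1_rinv (R : pzRingType) (q : R) :
  nilpotent_elt q -> exists u : R, (1 + q) * u = 1.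
Proof.
case=> n qn; exists (\sum_(i < n) (- q) ^+ i).
have := subrX1 (- q) n; rewrite exprNn qn mulr0 sub0r -opprD mulNr.
by rewrite addrC => /oppr_inj.
Qed.

(** The hypothesis is reapplied to the factor [a ^+ n] standing next to [r ^+ k], so [a] and [r]
    need not commute. *)
Lemma expr_pi_regular (R : pzRingType) (a r : R) (n k : nat) :
  a ^+ n = a ^+ n.+1 * r -> a ^+ n = a ^+ (n + k) * r ^+ k.
Proof.
move=> an; elim: k => [|k IHk]; first by rewrite addn0 expr0 mulr1.
by rewrite {1}IHk addnC exprD {1}an mulrA -exprD addnS addnC -mulrA -exprS addnS.
Qed.

Lemma central_pi_regular (R : pzRingType) (a : R) :
  weakly_nil_clean R -> (forall y, GRing.comm a y) ->
  exists n r, a ^+ n.+1 = a ^+ n.+2 * r.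
Proof.
move=> hR aC; have [e [q [ee [n qn] [r aE]]]] := hR a.
have [u qu] : exists u, (1 + q) * u = 1.
  by apply: nilpotent_add1_rinv; exists n.
have fe : (1 - e) * e = 0 by rewrite mulrBl mul1r ee subrr.
have fa : (1 - e) * a = (1 - e) * q.
  apply/eqP; rewrite -subr_eq0 -mulrBr -[a](subrK e) -addrA.
  by rewrite [e - q]addrC addrA aE mulrDr fe addr0 !mulrA fe !mul0r.
(* [e] and [q] may not commute, so [a] is moved: [(1 - e) q^k a = (1 - e) a q^k = (1 - e) q q^k]. *)
have fX k : (1 - e) * a ^+ k = (1 - e) * q ^+ k.
  elim: k => // k IHk.
  by rewrite exprSr mulrA IHk -mulrA -aC mulrA fa -mulrA -exprS.
have ea : e * (1 + q) = e * (1 - r) * a.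
  have /(congr1 ( *%R e)) : a - e - q = e * r * a by [].
  rewrite !mulrBr !mulrA ee => eaE.
  by rewrite mulrBl -eaE mulr1 mulrDr mulr1 -addrA -opprD subKr.
(* The exponent is [n.+1] because [n] may be 0. *)
exists n, (e * (1 - r) * u).
have -> : a ^+ n.+1 = a ^+ n.+1 * e.
  have aXC : a ^+ n.+1 * e = e * a ^+ n.+1 by apply/commr_sym/commrX/commr_sym/aC.
  apply/eqP; rewrite aXC -subr_eq0 -[X in X - _]mul1r -mulrBl fX.
  by rewrite exprS qn !mulr0.
have eE : e = a * (e * (1 - r) * u).
  by rewrite mulrA aC -ea -mulrA qu mulr1.
by rewrite [in LHS]eE mulrA -exprSr.
Qed.

(* [s] need not be central, but [c * s] is:
   [c * s * y = s * y * c = s * y * (c * c * s) = (c * c * s) * y * s = y * (c * s)]. *)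
Lemma central_regular (R : pzRingType) (c s : R) :
  (forall y, GRing.comm c y) -> c = c * c * s ->
  (forall y, GRing.comm (c * s * s) y) /\ c = c * c * (c * s * s).
Proof.
move=> cC cE.
have csE y : c * s * y = c * c * s * y * s.
  by rewrite -mulrA cC {1}cE !mulrA -[s * y * c]cC -[c * (s * y) * c]cC !mulrA.
have csC y : GRing.comm (c * s) y.
  by rewrite /GRing.comm csE mulrA -[y * c]cC [in RHS]cE.
split=> [y|].
  by rewrite /GRing.comm -mulrA csC mulrA -[s * y * c]cC !mulrA csC !mulrA.
by rewrite !mulrA -[c * c * c]mulrA -[c * (c * c) * s]mulrA -cE -cE.
Qed.

Lemma com_strongly_pi_regular_weakly_nil_clean (R : comPzRingType) :
  strongly_pi_regular R -> weakly_nil_clean R.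
Proof.
move=> hR a; have [[|n] [] // _ [r an]] := hR a.
(* The idempotent [f] generates the same ideal as [a ^+ n.+1], so [(1 - f) * a] is nilpotent;
   [f * r * a = f] puts [f] in [f R a]. *)
pose f := a ^+ n.+1 * r ^+ n.+1.
have fX : a ^+ n.+1 * f = a ^+ n.+1.
  by rewrite /f mulrA -exprD -(@expr_pi_regular _ _ _ _ n.+1 an).
have ff : f * f = f by rewrite {2}/f mulrA [f * _]mulrC fX.
have fra : f * r * a = f by rewrite mulrAC {1}/f [_ * a]mulrAC -exprSr mulrAC -an.
exists f, ((1 - f) * a); split=> //.
  by exists n.+1; rewrite exprMn exprSr -mulrA mulrBl mul1r [f * _]mulrC fX subrr mulr0.
exists (1 - r).
by rewrite mulrBr mulr1 !mulrBl mul1r fra opprB addrC addrA subrK.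
Qed.

Lemma center_strongly_pi_regular (R : pzRingType) :
  weakly_nil_clean R -> strongly_pi_regular (center R).
Proof.
move=> hR a; have /centralP aC := center_valP a.
have [n [r an]] := central_pi_regular _ _ hR aC.
set c := val a ^+ n.+1.
have [||tC cE] := @central_regular R c (r ^+ n.+1).
- by move=> y; apply/commr_sym/commrX/commr_sym/aC.
- by rewrite /c -exprD -expr_pi_regular.
have /centralP tcen := tC.
(* The factor [a ^+ n] absorbs the excess of [c * c = a ^+ (n.+1 + n.+1)] over [a ^+ n.+2]. *)
exists n.+1; split=> //; exists (a ^+ n * Center tcen).
apply: val_inj.
rewrite mulrA -exprD rmorphM !rmorphXn addSnnS exprD.
exact: cE.
Qed.

Theorem proposition3p19 (R : pzRingType) (hR : weakly_nil_clean R) :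
  weakly_nil_clean (center R) /\ strongly_pi_regular (center R).
Proof.
have hC := center_strongly_pi_regular R hR.
by split=> //; exact: com_strongly_pi_regular_weakly_nil_clean.
Qed.
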